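(* Let $q$ and $k$ be fixed natural numbers. For all $n$ such that $k\le n\le qk$, $$t_{q,k}(n)=\left[\begin{matrix}k\\ n-k\end{matrix}\right]_{q}.$$ Otherwise $n<k$ or $n>qk$, and $t_{q,k}(n)=0$. Furthermore, the generating function for $t_{q,k}(n)$ is $$\sum_{n=k}^{qk}t_{q,k}(n)x^n=x^{k}\left(1+x+\cdots+x^{q-1}\right)^{k}.$$
   Context: Natural numbers are positive integers, and $n$ ranges over natural numbers. A composition of $n$ into exactly $k$ parts is an ordered sequence $(a_1,\dots,a_k)$ of natural numbers (called its parts) with $n=a_1+a_2+\cdots+a_k$; sequences differing in order are different compositions. $t_{q,k}(n)$ denotes the number of compositions of $n$ into exactly $k$ parts, all of which are less than or equal to $q$. The symbol $\left[\begin{matrix}k\\ n\end{matrix}\right]_{q}$ denotes the coefficient of $x^n$ in the expansion of the polynomial $(1+x+\cdots+x^{q-1})^{k}$, i.e. $$(1+x+\cdots+x^{q-1})^{k}=\sum_{n=0}^{(q-1)k}\left[\begin{matrix}k\\ n\end{matrix}\right]_{q}x^n.$$ *)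

(* Defs.v *)
From mathcomp Require Import all_boot all_order all_algebra.

Set Implicit Arguments.
Unset Strict Implicit.
Unset Printing Implicit Defensive.

Import GRing.Theory.
Local Open Scope nat_scope.

Definition is_composition (n k : nat) (a : seq nat) : bool :=
  [&& size a == k, all (fun p => 0 < p) a & sumn a == n].

(* Tuples over 'I_n.+1 lose nothing: every part of a composition of n is
   at most n. *)
Definition bounded_compositions (q k n : nat) : {set k.-tuple 'I_n.+1} :=
  [set a : k.-tuple 'I_n.+1 |
    is_composition n k [seq val i | i <- a]
    && all (fun p => p <= q) [seq val i | i <- a]].

Definition num_compositions (q k n : nat) : nat :=
  #|bounded_compositions q k n|.

Definition geom_poly (q : nat) : {poly int} := (\sum_(i < q) 'X^i)%R.

(* As usual for polynomials, this is 0 when n exceeds (q - 1) * k. *)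
Definition poly_coefficient (q k n : nat) : int := ((geom_poly q ^+ k)`_n)%R.

(* Main.v *)
(** Expanding [('X * geom_poly q) ^+ k] as a product of sums, the coefficient
    of ['X^n] counts the maps [f : 'I_k -> 'I_q] with
    [\sum_i (f i).+1 = n], and [i |-> (f i).+1] is then the sequence of parts
    of a composition of [n]. *)
Require Import Defs.
From mathcomp Require Import all_boot all_order all_algebra.

Set Implicit Arguments.
Unset Strict Implicit.
Unset Printing Implicit Defensive.

Import GRing.Theory.

(** The bounds 1 and [q] on a part are built into the type ['I_q], and finite functions are the
    index set that arises when a product is distributed over sums. *)
Definition shifted_solutions (q k n : nat) : {set {ffun 'I_k -> 'I_q}} :=
  [set f : {ffun 'I_k -> 'I_q} | \sum_i (f i).+1 == n].

Lemma mem_bounded_compositions q k n (a : k.-tuple 'I_n.+1) :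
  (a \in bounded_compositions q k n) =
  [forall i, 0 < tnth a i <= q] && (\sum_i tnth a i == n).
Proof.
rewrite inE /is_composition size_map size_tuple eqxx /= !all_map.
rewrite sumnE big_map big_tuple andbAC; congr (_ && _).
apply/idP/forallP => [/andP[/allP a_gt0 /allP a_le] i | a_bnd].
  by rewrite [0 < _]a_gt0 ?mem_tnth //= [_ <= _]a_le ?mem_tnth.
by apply/andP; split; apply/allP => _ /tnthP[i ->] /=; case/andP: (a_bnd i).
Qed.

(** Adding one to each value is a bijection; the inverse takes predecessors, with [0 < q] giving the
    successor form that [inord] into ['I_q] requires. *)
Lemma num_compositionsE q k n :
  0 < q -> num_compositions q k n = #|shifted_solutions q k n|.
Proof.
case: q => // q _; set A := shifted_solutions _ _ _.
pose g (f : {ffun 'I_k -> 'I_q.+1}) : k.-tuple 'I_n.+1 :=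
  [tuple inord (f i).+1 | i < k].
(* On [A] every part is at most the whole sum [n], so [inord] does not fall back to its default
   value; hence [g] is shown injective on [A] only. *)
have gE f i : f \in A -> tnth (g f) i = (f i).+1 :> nat.
  rewrite inE => /eqP sum_f; rewrite tnth_mktuple inordK // ltnS -sum_f.
  by rewrite (bigD1 i) //= leq_addr.
rewrite -(card_in_imset (f := g)) => [|f1 f2 Af1 Af2 eq_g]; last first.
  by apply/ffunP => i; apply/val_inj/succn_inj; rewrite -!gE // eq_g.
apply: eq_card => a; rewrite mem_bounded_compositions.
apply/andP/imsetP => [[/forallP a_bnd /eqP sum_a] | [f Af ->]].
  pose f := [ffun i => inord (tnth a i).-1 : 'I_q.+1].
  have fE i : (f i).+1 = tnth a i.
    by case/andP: (a_bnd i) => a_gt0 a_le; rewrite ffunE inordK prednK.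
  have Af : f \in A by rewrite inE (eq_bigr _ (fun i _ => fE i)) sum_a.
  by exists f => //; apply: eq_from_tnth => i; apply: val_inj; rewrite /= gE.
split; first by apply/forallP => i; rewrite gE //= ltn_ord.
by under eq_bigr do rewrite gE //; move: Af; rewrite inE.
Qed.

Lemma coef_XnM_geom_poly q k n :
  (('X^k * geom_poly q ^+ k)`_n)%R = #|shifted_solutions q k n|%:Z%R.
Proof.
rewrite -exprMn -[X in (_ ^+ X)%R]card_ord -prodr_const /geom_poly mulr_sumr.
under eq_bigl do rewrite inE.
(* Both sides become sums over all [f]: on the left coefficients of monomials, on the right the
   indicator of the solution set. They agree term by term. *)
rewrite bigA_distr_bigA coef_sum -sum1_card -natz natr_sum [RHS]big_mkcond /=.
apply: eq_bigr => f _; rewrite inE eq_sym.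
under eq_bigr do rewrite -exprS.
by rewrite -(big_morph _ (exprD _) (expr0 _)) coefXn; case: ifP.
Qed.

Lemma num_compositions_coef q k n : 0 < q ->
  (num_compositions q k n)%:Z%R = (('X^k * geom_poly q ^+ k)`_n)%R.
Proof. by move=> q_gt0; rewrite num_compositionsE // coef_XnM_geom_poly. Qed.

Lemma num_compositions_eq0 q k n : 0 < q ->
  ~~ (k <= n <= q * k) -> num_compositions q k n = 0.
Proof.
move=> q_gt0 n_out; rewrite num_compositionsE //; apply: eq_card0 => f.
rewrite inE; apply: contraNF n_out => /eqP <-.
have sum_const m : \sum_(i < k) m = k * m by rewrite sum_nat_const card_ord.
(* With [k] and [q * k] written as constant sums of 1 and of [q], both bounds follow termwise. *)
rewrite mulnC -sum_const -[X in X <= _ <= _]muln1 -sum_const.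
by rewrite !leq_sum // => i _; apply: ltn_ord.
Qed.

Theorem theorem12 (q k : nat) (hq : (0 < q)%N) (hk : (0 < k)%N) :
  [/\ forall n : nat, (0 < n)%N -> (k <= n <= q * k)%N ->
        (num_compositions q k n)%:Z%R = poly_coefficient q k (n - k)%N,
      forall n : nat, (0 < n)%N -> ~ (k <= n <= q * k)%N ->
        ((n < k)%N \/ (q * k < n)%N) /\ num_compositions q k n = 0%N
    & (\sum_(k <= n < (q * k).+1) (num_compositions q k n)%:Z *: 'X^n
        = 'X^k * geom_poly q ^+ k :> {poly int})%R].
Proof.
split=> [n _ /andP[k_le_n _] | n _ /negP n_out |].
(* Multiplication by ['X^k] shifts coefficients by [k]; [k <= n] rules out the zero branch of
   [coefXnM]. *)
- by rewrite num_compositions_coef // coefXnM ltnNge k_le_n.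
- split; last exact: num_compositions_eq0.
  by apply/orP; rewrite !ltnNge -negb_and.
apply/polyP => m; rewrite -num_compositions_coef // coef_sum.
under eq_bigr do rewrite coefZ coefXn.
(* In range, only the term of index [m] contributes; out of range, both coefficients vanish. *)
case m_in: (m \in index_iota k (q * k).+1).
  rewrite (bigD1_seq m) ?iota_uniq //= eqxx mulr1 big1 ?addr0 // => i i_neq.
  by rewrite eq_sym (negPf i_neq) mulr0.
rewrite num_compositions_eq0 //; last by rewrite -[m <= _]ltnS -mem_index_iota m_in.
rewrite big_seq big1 // => i i_in; case: eqP m_in => [-> | _ _].
  by rewrite i_in.
by rewrite mulr0.
Qed.
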